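(* Let $C$ be a manifold with a foliation $\mathcal{F}$. For any $\beta\in\Omega^{1}(\mathcal{F})$, the following are equivalent: (1) $d_{\mathcal{F}}\beta=0$ and $d_{\nu}[\beta]=0$; (2) there exists an extension $\widetilde{\beta}\in\Omega^{1}(C)$ of $\beta$ such that $\iota_{V}d\widetilde{\beta}=0$ for all $V\in\Gamma(T\mathcal{F})$.
   Context: Everything is smooth. $\Omega^{k}(\mathcal{F})=\Gamma(\wedge^kT^{*}\mathcal{F})$, with leafwise de Rham differential $d_{\mathcal{F}}$ and cohomology $H^{\bullet}(\mathcal{F})$. An extension of $\beta\in\Omega^k(\mathcal{F})$ is a form $\widetilde\beta\in\Omega^k(C)$ whose restriction to $T\mathcal{F}$ is $\beta$. $N\mathcal{F}=TC/T\mathcal{F}$ carries the flat Bott $T\mathcal{F}$-connection $\nabla_X\overline{Y}=\overline{[X,Y]}$, with dual connection $\nabla^{*}$ on $N^{*}\mathcal{F}$; $H^{\bullet}(\mathcal{F};N^{*}\mathcal{F})$ is the cohomology of $\Omega^{k}(\mathcal{F};N^{*}\mathcal{F})=\Gamma(\wedge^kT^{*}\mathcal{F}\otimes N^{*}\mathcal{F})$ with the Koszul-type differential $d_{\nabla^{*}}$. The transverse differentiation map is $d_{\nu}:H^{k}(\mathcal{F})\to H^{k}(\mathcal{F};N^{*}\mathcal{F})$, $[\alpha]\mapsto[\mathsf{p}(d\widetilde{\alpha})]$, where $\widetilde{\alpha}\in\Omega^{k}(C)$ is any extension of $\alpha$, and for $\eta\in\Omega^{k+1}(C)$ vanishing when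 restricted to the leaves, $\langle \mathsf{p}(\eta)(V_1,\ldots,V_k),\overline{N}\rangle=\eta(V_1,\ldots,V_k,N)$ for $V_i\in\Gamma(T\mathcal{F})$, $\overline{N}\in\Gamma(N\mathcal{F})$. *)

(* Defs.v *)
From HB Require Import structures.
From mathcomp Require Import all_boot all_order all_algebra.
From mathcomp Require Import ring.
From mathcomp Require Import all_classical all_reals all_analysis.

Set Implicit Arguments.
Unset Strict Implicit.
Unset Printing Implicit Defensive.

Import Order.TTheory GRing.Theory Num.Theory.
Import numFieldNormedType.Exports.

Local Open Scope classical_set_scope.
Local Open Scope ring_scope.
Local Open Scope quotient_scope.

Section Euclidean.
Context {R : realType} {n : nat}.
Implicit Types (U : set 'rV[R]_n) (f g : 'rV[R]_n -> R).

(* [f] has on [U] continuous iterated partial derivatives of every order up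
   to [k]; [delta_mx 0 i] is the i-th standard basis vector. *)
Fixpoint Ck (k : nat) U f : Prop :=
  (forall x, U x -> {for x, continuous f}) /\
  if k is k'.+1 then
    forall i : 'I_n, (forall x, U x -> derivable f x (delta_mx 0 i)) /\
      Ck k' U (fun x => 'D_(delta_mx 0 i) f x)
  else True.

Definition Cinfty U f : Prop := forall k, Ck k U f.

Lemma Ck_cont k U f : Ck k U f -> forall x, U x -> {for x, continuous f}.
Proof. by case: k => [|k] []. Qed.

Lemma CkW k U f : Ck k.+1 U f -> Ck k U f.
Proof.
elim: k f => [|k IH] f; first by move=> [].
move=> [cf df]; split=> // i; have [? ?] := df i.
by split=> //; exact: IH.
Qed.

Lemma open_near U x : open U -> U x -> \forall y \near x, U y.
Proof. by move=> oU Ux; apply: open_nbhs_nbhs. Qed.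

Lemma Ck_eq k U f g : open U -> (forall x, U x -> f x = g x) ->
  Ck k U f -> Ck k U g.
Proof.
move=> oU; elim: k f g => [|k IH] f g fg [cf df].
  split=> // x Ux; have E : \forall y \near x, f y = g y.
    by near=> y; apply: fg; near: y; exact: open_near.
  rewrite /prop_for/continuous_at -(fg _ Ux).
  apply: cvg_trans (cf x Ux).
  exact: (@near_eq_cvg _ _ (nbhs x) _ f g E).
split.
  by apply: (@Ck_cont k); apply: (IH f) => //; exact: CkW.
move=> i; have [dfi Ci] := df i.
have Eg x : U x -> \forall y \near x, f y = g y.
  by move=> Ux; near=> y; apply: fg; near: y; exact: open_near.
split.
  move=> x Ux; apply: (near_eq_derivable (Eg x Ux)); exact: dfi.
apply: IH Ci => x Ux; apply: near_eq_derive; exact: Eg.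
Unshelve. all: by end_near.
Qed.

Lemma Ck_cst k U (c : R) : open U -> Ck k U (fun=> c).
Proof.
move=> oU; elim: k c => [|k IH] c.
  by split=> // x _; exact: cst_continuous.
split; first by move=> x _; exact: cst_continuous.
move=> i; split; first by move=> x _; exact: derivable_cst.
apply: (@Ck_eq k U (fun=> 0)) => // x _.
by rewrite -[RHS]/('D_(delta_mx 0 i) (cst c) x) derive_cst.
Qed.

Lemma Ck_add k U f g : open U -> Ck k U f -> Ck k U g -> Ck k U (f + g).
Proof.
move=> oU; elim: k f g => [|k IH] f g [cf df] [cg dg].
  by split=> // x Ux; apply: continuousD; [exact: cf|exact: cg].
split; first by move=> x Ux; apply: continuousD; [exact: cf|exact: cg].
move=> i; have [dfi Cf] := df i; have [dgi Cg] := dg i; split.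
  by move=> x Ux; apply: derivableD; [exact: dfi|exact: dgi].
apply: Ck_eq (IH _ _ Cf Cg) => // x Ux /=.
by rewrite deriveD //; [exact: dfi|exact: dgi].
Qed.

Lemma Ck_mul k U f g : open U -> Ck k U f -> Ck k U g -> Ck k U (f * g).
Proof.
move=> oU; elim: k f g => [|k IH] f g /[dup] Hf [cf df] /[dup] Hg [cg dg].
  by split=> // x Ux; apply: continuousM; [exact: cf|exact: cg].
split; first by move=> x Ux; apply: continuousM; [exact: cf|exact: cg].
move=> i; have [dfi Cf] := df i; have [dgi Cg] := dg i; split.
  by move=> x Ux; apply: derivableM; [exact: dfi|exact: dgi].
apply: Ck_eq (Ck_add oU (IH _ _ (CkW Hf) Cg) (IH _ _ (CkW Hg) Cf)) => // x Ux /=.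
by rewrite deriveM //; [exact: dfi|exact: dgi].
Qed.

End Euclidean.

(* [cmap] and [cinv] are total, but only meaningful on [cdom] and on
   [cmap @` cdom], between which they are mutually inverse homeomorphisms. *)
Record chart (R : realType) (n : nat) (T : topologicalType) := Chart {
  cdom : set T ;
  cmap :> T -> 'rV[R]_n ;
  cinv : 'rV[R]_n -> T ;
  cdom_open : open cdom ;
  cran_open : open (cmap @` cdom) ;
  cmapK : forall x, cdom x -> cinv (cmap x) = x ;
  cmap_cont : forall x, cdom x -> {for x, continuous cmap} ;
  cinv_cont : forall z, (cmap @` cdom) z -> {for z, continuous cinv} }.

Definition smooth_transition (R : realType) n (T : topologicalType)
    (phi psi : chart R n T) : Prop :=
  forall i, Cinfty (phi @` (cdom phi `&` cdom psi))
    (fun z => psi (cinv phi z) 0 i).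

(* The atlas need not be maximal: it stands for the smooth structure that it
   generates. *)
Record manifold (R : realType) (n : nat) := Manifold {
  mpoint :> topologicalType ;
  mhausdorff : hausdorff_space mpoint ;
  mcountable : @second_countable mpoint ;
  atlas : set (chart R n mpoint) ;
  atlas_cover : forall x, exists2 phi, atlas phi & cdom phi x ;
  atlas_compat : forall phi psi, atlas phi -> atlas psi ->
    smooth_transition phi psi }.

Arguments atlas {R n} m _.

(* A foliation of leaf dimension [p] and codimension [q], given by a foliated
   atlas for the smooth structure of [C].  In a foliated chart with values
   (x, y) in R^p x R^q the plaques are the slices y = constant, so a change of
   foliated charts is locally of the form (x, y) |-> (g(x, y), h(y)). *)
Record foliation (R : realType) (p q : nat) (C : manifold R (p + q)) :=
  Foliation {
  fcharts : set (chart R (p + q) C) ;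
  fcharts_cover : forall x, exists2 phi, fcharts phi & cdom phi x ;
  fcharts_compat : forall phi psi, fcharts phi -> atlas C psi ->
    smooth_transition phi psi /\ smooth_transition psi phi ;
  fcharts_plaques : forall phi psi, fcharts phi -> fcharts psi ->
    forall x, cdom phi x -> cdom psi x ->
      exists h : 'rV[R]_q -> 'rV[R]_q,
        \forall y \near x, rsubmx (psi y) = h (rsubmx (phi y)) }.

Section SmoothFunctions.
Context {R : realType} {n : nat}.
Context (C : manifold R n).
Implicit Types (U V : set C) (f g : C -> R).

Definition smooth_on U f : Prop := forall phi, atlas C phi ->
  Cinfty (phi @` (U `&` cdom phi)) (f \o cinv phi).

Definition smooth_at f (x : C) : Prop :=
  exists U, [/\ open U, U x & smooth_on U f].

Lemma chart_image_open (phi : chart R n C) U :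
  open U -> open (phi @` (U `&` cdom phi)).
Proof.
move=> oU; rewrite openE => _ [x [Ux dx] <-].
have rx : (phi @` cdom phi) (phi x) by exists x.
have := @cinv_cont _ _ _ phi _ rx U.
rewrite cmapK // => /(_ _) H.
have {}H : \forall z \near phi x, U (cinv phi z).
  by apply: H; exact: open_nbhs_nbhs.
have H' : \forall z \near phi x, (phi @` cdom phi) z.
  by apply: open_nbhs_nbhs; split=> //; exact: cran_open.
rewrite /interior /=; near=> z.
have Uz : U (cinv phi z) by near: z.
have [y dy yz] : (phi @` cdom phi) z by near: z.
by exists y => //; split=> //; move: Uz; rewrite -yz cmapK.
Unshelve. all: by end_near.
Qed.

Lemma smooth_on_eq U f g : open U -> (forall x, U x -> f x = g x) ->
  smooth_on U f -> smooth_on U g.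
Proof.
move=> oU fg sf phi aphi k; apply: Ck_eq (sf phi aphi k).
  exact: chart_image_open.
by move=> _ [x [Ux dx] <-] /=; rewrite cmapK // fg.
Qed.

Lemma smooth_on_cst U (c : R) : open U -> smooth_on U (fun=> c).
Proof. by move=> oU phi aphi k; apply: Ck_cst; exact: chart_image_open. Qed.

Lemma smooth_on_add U f g : open U ->
  smooth_on U f -> smooth_on U g -> smooth_on U (f + g).
Proof.
move=> oU sf sg phi aphi k.
rewrite -[_ \o _]/((f \o cinv phi) + (g \o cinv phi)).
by apply: Ck_add; [exact: chart_image_open|exact: sf|exact: sg].
Qed.

Lemma smooth_on_mul U f g : open U ->
  smooth_on U f -> smooth_on U g -> smooth_on U (f * g).
Proof.
move=> oU sf sg phi aphi k.
rewrite -[_ \o _]/((f \o cinv phi) * (g \o cinv phi)).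
by apply: Ck_mul; [exact: chart_image_open|exact: sf|exact: sg].
Qed.

Lemma smooth_on_opp U f : open U -> smooth_on U f -> smooth_on U (- f).
Proof.
move=> oU sf.
apply: (@smooth_on_eq U ((fun=> -1) * f)) => //.
  by move=> x _; rewrite -[LHS]/(-1 * f x) mulN1r.
by apply: smooth_on_mul => //; exact: smooth_on_cst.
Qed.

Lemma Ck_sub k (A B : set 'rV[R]_n) (h : 'rV[R]_n -> R) :
  A `<=` B -> Ck k B h -> Ck k A h.
Proof.
move=> AB; elim: k h => [|k IH] h [ch dh]; split=> //.
- by move=> x /AB; exact: ch.
- by move=> x /AB; exact: ch.
- move=> i; have [di Ci] := dh i; split; last exact: IH.
  by move=> x /AB; exact: di.
Qed.

Lemma smooth_on_sub U V f : U `<=` V -> smooth_on V f -> smooth_on U f.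
Proof.
move=> UV sf phi aphi k; apply: Ck_sub (sf phi aphi k).
by move=> _ [x [/UV Vx dx] <-]; exists x.
Qed.

Lemma smooth_on_at U f x : open U -> U x -> smooth_on U f -> smooth_at f x.
Proof. by exists U. Qed.

Lemma smooth_at2 f g x : smooth_at f x -> smooth_at g x ->
  exists U, [/\ open U, U x, smooth_on U f & smooth_on U g].
Proof.
move=> [U [oU Ux sf]] [V [oV Vx sg]]; exists (U `&` V); split=> //.
- exact: openI.
- by apply: smooth_on_sub sf => ? [].
- by apply: smooth_on_sub sg => ? [].
Qed.

Definition smoothfun : pred (C -> R) := fun f => `[< smooth_on setT f >].

Lemma smoothfun_subring : subring_closed smoothfun.
Proof.
split.
- by apply/asboolP; apply: (smooth_on_cst 1); exact: openT.
- move=> f g /asboolP sf /asboolP sg; apply/asboolP.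
  apply: smooth_on_add => //; first exact: openT.
  by apply: smooth_on_opp => //; exact: openT.
- move=> f g /asboolP sf /asboolP sg; apply/asboolP.
  by apply: smooth_on_mul => //; exact: openT.
Qed.

Record Cinf := MkCinf { Cinf_fun :> C -> R ; _ : Cinf_fun \in smoothfun }.

HB.instance Definition _ := [isSub for Cinf_fun].
HB.instance Definition _ := [Choice of Cinf by <:].
HB.instance Definition _ :=
  GRing.SubChoice_isSubComPzRing.Build _ smoothfun Cinf smoothfun_subring.

End SmoothFunctions.
Arguments smoothfun {R n} C _.

Section VectorFields.
Context {R : realType} {n : nat}.
Context (C : manifold R n).
Implicit Types (U : set C) (f g : C -> R) (x : C) (v : (C -> R) -> R).
Implicit Types (D E : C -> (C -> R) -> R).

(* Tangent vectors at [x] are the derivations of the ring of germs at [x] of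
   smooth functions.  A germ is represented by a total function that is smooth
   near [x]; the value 0 imposed on functions that are not smooth near [x]
   makes equality of derivations coincide with Leibniz equality. *)
Definition is_tangent x v : Prop := [/\
  forall (a : R) f g, smooth_at f x -> smooth_at g x ->
    v (fun y => a * f y + g y) = a * v f + v g,
  forall f g, smooth_at f x -> smooth_at g x ->
    v (fun y => f y * g y) = v f * g x + f x * v g,
  forall f g, (\forall y \near x, f y = g y) -> v f = v g &
  forall f, ~ smooth_at f x -> v f = 0].

(* A smooth section of TC, also acting on functions that are only locally
   defined and smooth. *)
Definition is_vfield D : Prop :=
  (forall x, is_tangent x (D x)) /\
  forall U f, open U -> smooth_on U f -> smooth_on U (fun x => D x f).

Definition vfield_pred : pred (C -> (C -> R) -> R) := fun D => `[< is_vfield D >].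

Lemma smooth_at_near f g x : (\forall y \near x, f y = g y) ->
  smooth_at f x -> smooth_at g x.
Proof.
rewrite -[X in X -> _]/(nbhs x [set y | f y = g y]) nbhsE => -[B [oB Bx] fg].
move=> [U [oU Ux sf]]; exists (B `&` U); split=> //; first exact: openI.
apply: (@smooth_on_eq _ _ _ _ f); first exact: openI.
  by move=> y [/fg].
by apply: smooth_on_sub sf => ? [].
Qed.

Lemma is_tangent0 x : is_tangent x (fun=> 0).
Proof. by split=> // *; rewrite ?mulr0 ?mul0r addr0. Qed.

Lemma is_tangentB x v w : is_tangent x v -> is_tangent x w ->
  is_tangent x (v - w).
Proof.
move=> [vl vp vn v0] [wl wp wn w0]; split.
- by move=> a f g sf sg; rewrite !fctE vl ?wl //; ring.
- by move=> f g sf sg; rewrite !fctE vp ?wp //; ring.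
- by move=> f g fg; rewrite !fctE (vn f g) ?(wn f g).
- by move=> f sf; rewrite !fctE v0 ?w0 // subr0.
Qed.

Lemma is_tangentZ x (c : R) v : is_tangent x v -> is_tangent x (fun f => c * v f).
Proof.
move=> [vl vp vn v0]; split.
- by move=> a f g sf sg; rewrite vl //; ring.
- by move=> f g sf sg; rewrite vp //; ring.
- by move=> f g fg; rewrite (vn f g).
- by move=> f sf; rewrite v0 // mulr0.
Qed.

Lemma vfield_zmod : zmod_closed vfield_pred.
Proof.
split.
  apply/asboolP; split; first exact: is_tangent0.
  by move=> U f oU _; exact: smooth_on_cst.
move=> D E /asboolP [tD sD] /asboolP [tE sE]; apply/asboolP; split.
  by move=> x; apply: is_tangentB.
move=> U f oU sf.
rewrite -[X in smooth_on _ X]/((fun x => D x f) + - (fun x => E x f)).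
apply: smooth_on_add => //; first exact: sD.
by apply: smooth_on_opp => //; exact: sE.
Qed.

Record vfield := MkVfield
  { vfield_fun :> C -> (C -> R) -> R ; _ : vfield_fun \in vfield_pred }.

HB.instance Definition _ := [isSub for vfield_fun].
HB.instance Definition _ := [Choice of vfield by <:].
HB.instance Definition _ :=
  GRing.SubChoice_isSubZmodule.Build _ vfield_pred vfield vfield_zmod.

Lemma vfieldP (X : vfield) : is_vfield X.
Proof. by have /asboolP := valP X. Qed.

Lemma CinfP (f : Cinf C) : smooth_on setT f.
Proof. by have /asboolP := valP f. Qed.

Lemma vfield_eq (X Y : vfield) : (forall x f, X x f = Y x f) -> X = Y.
Proof. by move=> XY; apply: val_inj; apply/funext => x; apply/funext => f; exact: XY. Qed.

Lemma Cinf_eq (f g : Cinf C) : (forall x, f x = g x) -> f = g.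
Proof. by move=> fg; apply: val_inj; exact/funext. Qed.

Lemma vscale_subproof (f : Cinf C) (X : vfield) :
  (fun x g => f x * X x g) \in vfield_pred.
Proof.
have [tX sX] := vfieldP X.
apply/asboolP; split; first by move=> x; exact: is_tangentZ.
move=> U g oU sg.
apply: (@smooth_on_mul _ _ _ U f (fun x => X x g)) => //; last exact: sX.
by apply: smooth_on_sub (CinfP f).
Qed.

Definition vscale (f : Cinf C) (X : vfield) : vfield := MkVfield (vscale_subproof f X).

Lemma vscaleA (f g : Cinf C) X : vscale f (vscale g X) = vscale (f * g) X.
Proof. by apply: vfield_eq => x h /=; rewrite mulrA. Qed.

Lemma vscale1 : left_id 1 vscale.
Proof. by move=> X; apply: vfield_eq => x h /=; rewrite mul1r. Qed.

Lemma vscaleDr : right_distributive vscale +%R.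
Proof. by move=> f X Y; apply: vfield_eq => x h /=; rewrite mulrDr. Qed.

Lemma vscaleDl (X : vfield) : {morph vscale^~ X : f g / f + g}.
Proof. by move=> f g; apply: vfield_eq => x h /=; rewrite mulrDl. Qed.

HB.instance Definition _ := GRing.Zmodule_isLmodule.Build (Cinf C) vfield
  vscaleA vscale1 vscaleDr vscaleDl.

Lemma vact_subproof (X : vfield) (f : Cinf C) :
  (fun x => X x f) \in smoothfun C.
Proof.
have [tX sX] := vfieldP X.
by apply/asboolP; apply: sX (CinfP f); exact: openT.
Qed.

Definition vact (X : vfield) (f : Cinf C) : Cinf C := MkCinf (vact_subproof X f).

(* The test only enforces the convention of [is_tangent] for functions that
   are not smooth near [x]. *)
Definition lie_fun D E x f : R :=
  if `[< smooth_at f x >] then D x (fun y => E y f) - E x (fun y => D y f) else 0.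

Lemma lie_funE D E x f : smooth_at f x ->
  lie_fun D E x f = D x (fun y => E y f) - E x (fun y => D y f).
Proof. by rewrite /lie_fun => /asboolT ->. Qed.


Lemma is_tangent_cst0 x v : is_tangent x v -> v (fun=> 0) = 0.
Proof.
move=> [vl _ _ _].
have s0 : smooth_at (fun=> 0 : R) x.
  by apply: (@smooth_on_at _ _ _ setT) => //; [exact: openT|
    apply: smooth_on_cst; exact: openT].
have := vl 1 _ _ s0 s0.
rewrite (_ : (fun=> _) = fun=> 0); last by apply/funext => y; rewrite mulr0 addr0.
by rewrite mul1r -{1}[v _]addr0 => /addrI /esym.
Qed.

Lemma lie_subproof (X Y : vfield) : lie_fun X Y \in vfield_pred.
Proof.
have [tX sX] := vfieldP X; have [tY sY] := vfieldP Y.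
have sat (Z : vfield) f x : smooth_at f x -> smooth_at (fun y => Z y f) x.
  move=> [U [oU Ux sf]]; exists U; split=> //.
  by case: (vfieldP Z) => _; exact.
have nearE (P : C -> Prop) x U : open U -> U x -> (forall y, U y -> P y) ->
    \forall y \near x, P y.
  move=> oU Ux UP; apply: (@filterS _ (nbhs x) _ U) => //.
  exact: open_nbhs_nbhs.
have linE (Z W : vfield) (a : R) f g x : smooth_at f x -> smooth_at g x ->
    Z x (fun y => W y (fun t => a * f t + g t)) =
    a * Z x (fun y => W y f) + Z x (fun y => W y g).
  move=> sf sg; have [U [oU Ux sUf sUg]] := smooth_at2 sf sg.
  have [Zl _ Zn _] := (vfieldP Z).1 x.
  rewrite -(Zl a (fun y => W y f) (fun y => W y g) (sat W _ _ sf) (sat W _ _ sg)).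
  apply: Zn; apply: (nearE _ _ _ oU Ux) => y Uy.
  by have [Wl _ _ _] := (vfieldP W).1 y; rewrite Wl //; apply: (smooth_on_at oU Uy).
have prodE (Z W : vfield) f g x : smooth_at f x -> smooth_at g x ->
    Z x (fun y => W y (fun t => f t * g t)) =
    Z x (fun y => W y f) * g x + W x f * Z x g
    + (Z x f * W x g + f x * Z x (fun y => W y g)).
  move=> sf sg; have [U [oU Ux sUf sUg]] := smooth_at2 sf sg.
  have [Zl Zp Zn _] := (vfieldP Z).1 x.
  rewrite -(Zp (fun y => W y f) g (sat W _ _ sf) sg).
  rewrite -(Zp f (fun y => W y g) sf (sat W _ _ sg)).
  have sp h k : smooth_at h x -> smooth_at k x -> smooth_at (fun y => h y * k y) x.
    move=> sh sk; have [V [oV Vx sVh sVk]] := smooth_at2 sh sk.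
    by exists V; split=> //; apply: (smooth_on_mul oV sVh sVk).
  rewrite -[X in X + _]mul1r -Zl; [|by apply: sp => //; exact: sat..].
  apply: Zn; apply: (nearE _ _ _ oU Ux) => y Uy; rewrite mul1r.
  by have [_ Wp _ _] := (vfieldP W).1 y; rewrite Wp //; apply: (smooth_on_at oU Uy).
apply/asboolP; split.
  move=> x; split.
  - move=> a f g sf sg; have [U [oU Ux sUf sUg]] := smooth_at2 sf sg.
    have sfg : smooth_at (fun y => a * f y + g y) x.
      exists U; split=> //.
      apply: (@smooth_on_add _ _ _ U (fun y => a * f y) g) => //.
      by apply: (@smooth_on_mul _ _ _ U (fun=> a) f) => //; exact: smooth_on_cst.
    by rewrite !lie_funE // !linE //; ring.
  - move=> f g sf sg; have [U [oU Ux sUf sUg]] := smooth_at2 sf sg.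
    have sfg : smooth_at (fun y => f y * g y) x.
      by exists U; split=> //; apply: (smooth_on_mul oU sUf sUg).
    by rewrite !lie_funE // !prodE //; ring.
  - move=> f g fg.
    have [sf|nsf] := pselect (smooth_at f x); last first.
      rewrite /lie_fun !asboolF // => sg; apply: nsf.
      apply: smooth_at_near sg; near=> y; apply/esym; near: y; exact: fg.
    have sg : smooth_at g x := smooth_at_near fg sf.
    have congE (Z W : vfield) : Z x (fun y => W y f) = Z x (fun y => W y g).
      have [_ _ Zn _] := (vfieldP Z).1 x; apply: Zn.
      move: fg; rewrite -[X in X -> _]/(nbhs x [set y | f y = g y]) nbhsE.
      move=> -[B [oB Bx] Bfg]; apply: (nearE _ _ _ oB Bx) => y By.
      have [_ _ Wn _] := (vfieldP W).1 y; apply: Wn.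
      exact: (nearE _ _ _ oB By).
    by rewrite !lie_funE // !congE.
  - by move=> f nsf; rewrite /lie_fun asboolF.
move=> U f oU sf.
apply: (@smooth_on_eq _ _ _ _
  ((fun x => X x (fun y => Y y f)) + - (fun x => Y x (fun y => X y f)))) => //.
  by move=> x Ux; rewrite lie_funE //; apply: (smooth_on_at oU Ux).
apply: smooth_on_add => //; first by apply: sX => //; exact: sY.
by apply: smooth_on_opp => //; apply: sY => //; exact: sX.
Unshelve. all: by end_near.
Qed.

Definition lie (X Y : vfield) : vfield := MkVfield (lie_subproof X Y).

End VectorFields.

Section LieAlgebra.
Context {R : realType} {n : nat}.
Context (C : manifold R n).
Implicit Types (X Y Z : vfield C) (f g : Cinf C).

Lemma vactE X f x : vact X f x = X x f. Proof. by []. Qed.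

Lemma smooth_at_Cinf f x : smooth_at f x.
Proof. by apply: (smooth_on_at _ _ (CinfP f)) => //; exact: openT. Qed.

Lemma smooth_at_vfield X (f : C -> R) x :
  smooth_at f x -> smooth_at (fun y => X y f) x.
Proof.
move=> [U [oU Ux sf]]; apply: (smooth_on_at oU Ux).
by case: (vfieldP X) => _; exact.
Qed.

Lemma vfieldD_at X (f g : C -> R) x : smooth_at f x -> smooth_at g x ->
  X x (fun y => f y + g y) = X x f + X x g.
Proof.
move=> sf sg; have [Xl _ _ _] := (vfieldP X).1 x.
have := Xl 1 f g sf sg; rewrite mul1r => <-.
by congr (X x _); apply/funext => y; rewrite mul1r.
Qed.

Lemma vfieldM_at X (f g : C -> R) x : smooth_at f x -> smooth_at g x ->
  X x (fun y => f y * g y) = X x f * g x + f x * X x g.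
Proof. by have [_ + _ _] := (vfieldP X).1 x; exact. Qed.

Lemma vact_is_additive X : zmod_morphism (vact X).
Proof.
move=> f g; apply: Cinf_eq => x /=.
have [Xl _ _ _] := (vfieldP X).1 x.
have := Xl (-1) g f (smooth_at_Cinf _ _) (smooth_at_Cinf _ _).
rewrite (_ : (fun y => _) = (f - g)); last first.
  by apply/funext => y; rewrite mulN1r addrC.
by move=> ->; rewrite mulN1r addrC.
Qed.

HB.instance Definition _ X :=
  GRing.isZmodMorphism.Build (Cinf C) (Cinf C) (vact X) (vact_is_additive X).

Lemma vactM X f g : vact X (f * g) = vact X f * g + f * vact X g.
Proof.
apply: Cinf_eq => x /=.
by apply: vfieldM_at; exact: smooth_at_Cinf.
Qed.

Lemma vactDl X Y f : vact (X + Y) f = vact X f + vact Y f.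
Proof. exact: Cinf_eq. Qed.

Lemma vactBl X Y f : vact (X - Y) f = vact X f - vact Y f.
Proof. exact: Cinf_eq. Qed.

Lemma vactZl g X f : vact (g *: X) f = g * vact X f.
Proof. exact: Cinf_eq. Qed.

Lemma lie_lact X Y f : vact (lie X Y) f = vact X (vact Y f) - vact Y (vact X f).
Proof. by apply: Cinf_eq => x; rewrite vactE /= lie_funE //; exact: smooth_at_Cinf. Qed.

Lemma vfield_eq_at X Y :
  (forall x (f : C -> R), smooth_at f x -> X x f = Y x f) -> X = Y.
Proof.
move=> XY; apply: vfield_eq => x f; have [|nsf] := pselect (smooth_at f x).
  exact: XY.
have [_ _ _ X0] := (vfieldP X).1 x; have [_ _ _ Y0] := (vfieldP Y).1 x.
by rewrite X0 // Y0.
Qed.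

Lemma lieC X Y : lie X Y = - lie Y X.
Proof.
by apply: vfield_eq_at => x f sf; rewrite /= !fctE !lie_funE // opprB.
Qed.

Lemma lieDr X Y Z : lie X (Y + Z) = lie X Y + lie X Z.
Proof.
apply: vfield_eq_at => x f sf; rewrite /= !fctE !lie_funE //=.
rewrite vfieldD_at; [|exact: smooth_at_vfield..].
by rewrite !fctE; ring.
Qed.

Lemma lieZr f X Y : lie X (f *: Y) = f *: lie X Y + vact X f *: Y.
Proof.
apply: vfield_eq_at => x g sg; rewrite /= !fctE /= !lie_funE //=.
by rewrite vfieldM_at; [ring|exact: smooth_at_Cinf|exact: smooth_at_vfield].
Qed.

Lemma lie_is_additive X : zmod_morphism (lie X).
Proof.
move=> Y Z; apply/eqP; rewrite -subr_eq opprK -lieDr subrK.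
by rewrite eqxx.
Qed.

HB.instance Definition _ X :=
  GRing.isZmodMorphism.Build (vfield C) (vfield C) (lie X) (lie_is_additive X).

Lemma lieDl X Y Z : lie (X + Y) Z = lie X Z + lie Y Z.
Proof. by rewrite lieC raddfD /= opprD -!lieC. Qed.

Lemma lieZl f X Y : lie (f *: X) Y = f *: lie X Y - vact Y f *: X.
Proof. by rewrite lieC lieZr opprD -scalerN -lieC. Qed.

Lemma lie_jacobi X Y Z : lie X (lie Y Z) = lie (lie X Y) Z + lie Y (lie X Z).
Proof.
apply: vfield_eq_at => x f sf.
have sU : \forall y \near x, smooth_at f y.
  have [U [oU Ux sfU]] := sf.
  apply: (@filterS _ (nbhs x) _ U); last exact: open_nbhs_nbhs.
  by move=> y Uy; exact: (smooth_on_at oU Uy).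
have E (A B D : vfield C) : A x (fun y => lie_fun B D y f) =
    A x (fun y => B y (fun z => D z f)) - A x (fun y => D y (fun z => B z f)).
  have [Al _ An _] := (vfieldP A).1 x.
  have sat (B' D' : vfield C) : smooth_at (fun y => B' y (fun z => D' z f)) x.
    by do 2!apply: smooth_at_vfield.
  rewrite -mulN1r addrC -(Al _ _ _ (sat _ _) (sat _ _)); apply: An.
  near=> y; rewrite /= lie_funE; first by rewrite mulN1r addrC.
  by near: y.
have sa (A : vfield C) : smooth_at (fun y => A y f) x by exact: smooth_at_vfield.
rewrite /= !fctE !(lie_funE _ _ sf) /= !E !(lie_funE _ _ (sa _)).
ring.
Unshelve. all: by end_near.
Qed.

(* Sections of a bundle built from TC, TF and NF by duals and exterior powers
   are represented, as usual, by multilinear maps over the ring of smooth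
   functions on the modules of sections. *)
Definition Omega1C := {linear vfield C -> (Cinf C)^o}.

Definition dC (a : vfield C -> Cinf C) X Y : Cinf C :=
  vact X (a Y) - vact Y (a X) - a (lie X Y).

Lemma form1D (a : Omega1C) X Y : a (X + Y) = a X + a Y.
Proof. exact: raddfD. Qed.

Lemma form1Z (a : Omega1C) f X : a (f *: X) = f * a X.
Proof. exact: linearZ. Qed.

Lemma dCC (a : Omega1C) X Y : dC a X Y = - dC a Y X.
Proof. by rewrite /dC [lie Y X]lieC raddfN; ring. Qed.

Lemma dCr (a : Omega1C) X f Y Z : dC a X (f *: Y + Z) = f * dC a X Y + dC a X Z.
Proof.
rewrite /dC lieDr lieZr !form1D !form1Z !raddfD /= !vactM vactDl vactZl.
ring.
Qed.

Lemma dCl (a : Omega1C) X f Y Z : dC a (f *: Y + Z) X = f * dC a Y X + dC a Z X.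
Proof. by rewrite dCC dCr [dC a Y X]dCC [dC a Z X]dCC; ring. Qed.

Lemma ddC (a : Omega1C) X Y Z :
  vact X (dC a Y Z) - vact Y (dC a X Z) + vact Z (dC a X Y)
  - dC a (lie X Y) Z + dC a (lie X Z) Y - dC a (lie Y Z) X = 0.
Proof.
have J1 : a (lie (lie Y Z) X) = - a (lie (lie X Y) Z) - a (lie Y (lie X Z)).
  by rewrite lieC raddfN /= (lie_jacobi X Y Z) form1D opprD.
have J2 : a (lie (lie X Z) Y) = - a (lie Y (lie X Z)) by rewrite lieC raddfN.
rewrite /dC J1 J2 !raddfB /= !lie_lact.
ring.
Qed.

End LieAlgebra.

Section FoliatedForms.
Context {R : realType} {p q : nat} {C : manifold R (p + q)}.
Context (F : foliation C).
Implicit Types (X Y Z : vfield C) (f g : Cinf C).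

(* Sections of TF.  The tangent space of the leaf through [x] is the tangent
   space of the plaque through [x], that is, the kernel of the differential at
   [x] of the transverse coordinates y_j of a foliated chart. *)
Definition tangent_pred : pred (vfield C) := fun X =>
  `[< forall phi, fcharts F phi -> forall x, cdom phi x ->
        forall j, X x (fun y => rsubmx (phi y) 0 j) = 0 >].

Lemma tangent_submod : subsemimod_closed tangent_pred.
Proof.
split; first split.
- by apply/asboolP.
- move=> X Y /asboolP tX /asboolP tY; apply/asboolP => phi Fphi x dx j.
  by rewrite /= !fctE tX // tY // addr0.
- move=> f X /asboolP tX; apply/asboolP => phi Fphi x dx j.
  by rewrite /= tX // mulr0.
Qed.

HB.instance Definition _ := GRing.isSubmodClosed.Build _ _ tangent_pred tangent_submod.

Record TF := MkTF { TF_val :> vfield C ; _ : TF_val \in tangent_pred }.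

HB.instance Definition _ := [isSub for TF_val].
HB.instance Definition _ := [Choice of TF by <:].
HB.instance Definition _ := [SubChoice_isSubLmodule of TF by <:].

Lemma TFP (V : TF) : (V : vfield C) \in tangent_pred.
Proof. exact: valP. Qed.

Lemma tangent_lie X Y : X \in tangent_pred -> Y \in tangent_pred ->
  lie X Y \in tangent_pred.
Proof.
move=> /asboolP tX /asboolP tY; apply/asboolP => phi Fphi x dx j /=.
rewrite /lie_fun; case: asboolP => // _.
have near0 Z : (forall y, cdom phi y -> Z y (fun y => rsubmx (phi y) 0 j) = 0) ->
    \forall y \near x, Z y (fun y => rsubmx (phi y) 0 j) = 0.
  move=> Z0; apply: (@filterS _ (nbhs x) _ (cdom phi)) => //.
  by apply: open_nbhs_nbhs; split=> //; exact: cdom_open.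
have zero X' Y' : (forall y, cdom phi y -> Y' y (fun y => rsubmx (phi y) 0 j) = 0) ->
    X' x (fun y => Y' y (fun y => rsubmx (phi y) 0 j)) = 0.
  move=> /near0 Y0; have tX' := (vfieldP X').1 x; have [_ _ Xn _] := tX'.
  by rewrite -(is_tangent_cst0 tX'); exact: Xn.
by rewrite !zero ?subr0 // => y dy; [exact: tX|exact: tY].
Qed.

Definition lieF (V W : TF) : TF := MkTF (tangent_lie (TFP V) (TFP W)).

(* Sections of the normal bundle NF = TC/TF. *)
Definition NF := @Quotient.quot (vfield C) (GRing.ZmodClosed.clone _ tangent_pred _).

HB.instance Definition _ := Choice.on NF.
HB.instance Definition _ := GRing.Zmodule.on NF.

Definition NFbar X : NF := \pi X.

Lemma NFbar_eq X Y : X - Y \in tangent_pred -> NFbar X = NFbar Y.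
Proof. by rewrite Quotient.idealrBE => /eqP. Qed.

Lemma NFbar_repr (N : NF) : NFbar (repr N) = N.
Proof. exact: reprK. Qed.

Lemma repr_NFbar X : repr (NFbar X) - X \in tangent_pred.
Proof. by rewrite Quotient.idealrBE reprK. Qed.

Lemma NFbarD X Y : NFbar (X + Y) = NFbar X + NFbar Y.
Proof. exact: raddfD. Qed.

Definition NFscale f (N : NF) : NF := NFbar (f *: repr N).

Lemma NFscaleE f X : NFscale f (NFbar X) = NFbar (f *: X).
Proof. by apply: NFbar_eq; rewrite -scalerBr rpredZ // repr_NFbar. Qed.

Lemma NFscaleA f g N : NFscale f (NFscale g N) = NFscale (f * g) N.
Proof. by rewrite -[N]NFbar_repr !NFscaleE scalerA. Qed.

Lemma NFscale1 : left_id 1 NFscale.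
Proof. by move=> N; rewrite -[N]NFbar_repr !NFscaleE scale1r. Qed.

Lemma NFscaleDr : right_distributive NFscale +%R.
Proof.
move=> f N M; rewrite -[N]NFbar_repr -[M]NFbar_repr.
by rewrite -NFbarD !NFscaleE scalerDr NFbarD.
Qed.

Lemma NFscaleDl N : {morph NFscale^~ N : f g / f + g}.
Proof. by move=> f g; rewrite -[N]NFbar_repr !NFscaleE scalerDl NFbarD. Qed.

HB.instance Definition _ := GRing.Zmodule_isLmodule.Build (Cinf C) NF
  NFscaleA NFscale1 NFscaleDr NFscaleDl.

Lemma NFbarZ f X : NFbar (f *: X) = f *: NFbar X.
Proof. by rewrite -NFscaleE. Qed.

(* Independent of the representative of [N], see [bott_connE]. *)
Definition bott_conn (V : TF) (N : NF) : NF := NFbar (lie V (repr N)).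

Lemma bott_connE (V : TF) X : bott_conn V (NFbar X) = NFbar (lie V X).
Proof.
by apply: NFbar_eq; rewrite -raddfB; exact: tangent_lie (TFP V) (repr_NFbar X).
Qed.

Definition Omega1F := {linear TF -> (Cinf C)^o}.
Definition GammaNdual := {linear NF -> (Cinf C)^o}.

Definition extension_of (a : Omega1C C) (b : Omega1F) : Prop := forall V : TF, a V = b V.

Definition dF0 f (V : TF) : Cinf C := vact V f.

Definition dF (b : TF -> Cinf C) (V W : TF) : Cinf C :=
  vact V (b W) - vact W (b V) - b (lieF V W).

(* The connection dual to the Bott connection:
   < nabla*_V c, N > = V < c, N > - < c, nabla_V N >. *)
Definition nabla_dual (V : TF) (c : NF -> Cinf C) (N : NF) : Cinf C :=
  vact V (c N) - c (bott_conn V N).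

(* The differential d_{nabla*} on N*F-valued leafwise forms of degree 0 and 1,
   the latter being represented by maps [w] with [is_Omega1N w]. *)
Definition dN0 (c : NF -> Cinf C) (V : TF) (N : NF) : Cinf C := nabla_dual V c N.

Definition dN1 (w : TF -> NF -> Cinf C) (V W : TF) (N : NF) : Cinf C :=
  nabla_dual V (w W) N - nabla_dual W (w V) N - w (lieF V W) N.

Definition is_Omega1N (w : TF -> NF -> Cinf C) : Prop :=
  (forall V, linear (w V : NF -> (Cinf C)^o)) /\
  (forall N, linear (w^~ N : TF -> (Cinf C)^o)).

(* The map p.  For [e] vanishing on the leaves it does not depend on the
   representative of [N], see [transverse_part_dC]. *)
Definition transverse_part (e : vfield C -> vfield C -> Cinf C) (V : TF) (N : NF) : Cinf C :=
  e V (repr N).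

(* Cohomology classes are cosets of the space of exact forms. *)
Definition H1F_class (b : Omega1F) : set Omega1F :=
  [set b' | exists f, forall V, b' V = b V + dF0 f V].

Definition H1N_class (w : TF -> NF -> Cinf C) : set (TF -> NF -> Cinf C) :=
  [set w' | exists c : GammaNdual, forall V N, w' V N = w V N + dN0 c V N].

(* The class [b] is sent to the coset of p(d a) for the extensions [a] of its
   representatives; by [dnuE] it is the same coset for all [a]. *)
Definition dnu (A : set Omega1F) : set (TF -> NF -> Cinf C) :=
  [set w | exists b a, [/\ A b, extension_of a b & H1N_class (transverse_part (dC a)) w]].

Lemma dC_leaf (a : Omega1C C) (b : Omega1F) : extension_of a b ->
  forall V W : TF, dC a V W = dF b V W.
Proof. by move=> ab V W; rewrite /dC /dF !ab -[lie V W]/(TF_val (lieF V W)) ab. Qed.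

Lemma transverse_part_dC (a : Omega1C C) : (forall V W : TF, dC a V W = 0) ->
  forall V X, transverse_part (dC a) V (NFbar X) = dC a V X.
Proof.
move=> a0 V X; rewrite /transverse_part -[repr _](subrK X) -[_ - X]scale1r dCr.
by rewrite -[repr _ - X]/(TF_val (MkTF (repr_NFbar X))) a0 mulr0 add0r.
Qed.

Section Descent.
Context (a : Omega1C C) (a0 : forall V : TF, a V = 0).

Definition descend (N : NF) : (Cinf C)^o := a (repr N).

Lemma descendE X : descend (NFbar X) = a X.
Proof.
rewrite /descend -[repr _](subrK X) form1D.
by rewrite -[repr _ - X]/(TF_val (MkTF (repr_NFbar X))) a0 add0r.
Qed.

Lemma descend_is_linear : linear descend.
Proof.
move=> f N M; rewrite -[N]NFbar_repr -[M]NFbar_repr.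
by rewrite -NFbarZ -NFbarD !descendE linearP.
Qed.

HB.instance Definition _ :=
  GRing.isLinear.Build (Cinf C) NF (Cinf C)^o _ descend descend_is_linear.

End Descent.

Lemma dnuE (a : Omega1C C) (b : Omega1F) : (forall V W, dF b V W = 0) ->
  extension_of a b -> dnu (H1F_class b) = H1N_class (transverse_part (dC a)).
Proof.
move=> b0 ab; have a0 (V W : TF) : dC a V W = 0 by rewrite (dC_leaf ab).
apply/seteqP; split=> w; last first.
  move=> wa; exists b, a; split=> //.
  by exists 0 => V; rewrite /dF0 raddf0 addr0.
move=> [b' [a' [[f b'E] a'b' [c wE]]]].
pose h X : (Cinf C)^o := a' X - a X - vact X f.
have h_lin : linear h.
  move=> g X Y; rewrite /h !form1D !form1Z vactDl vactZl.
  by rewrite -[_ *: _]/(_ * _); ring.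
pose H : Omega1C C := HB.pack h (GRing.isLinear.Build _ _ _ _ h h_lin).
have H0 (V : TF) : H V = 0.
  by rewrite -[H V]/(h V) /h a'b' ab b'E /dF0 addrAC addrK subrr.
have dH X Y : dC H X Y = dC a' X Y - dC a X Y.
  by rewrite /dC -![H _]/(h _) /h !raddfB /= lie_lact; ring.
have a'0 (V W : TF) : dC a' V W = 0.
  have /esym := dH V W; rewrite a0 subr0 => ->.
  by rewrite /dC !H0 !raddf0 -[lie V W]/(TF_val (lieF V W)) H0 ?subr0 ?addr0.
pose k N : (Cinf C)^o := c N + descend H N.
have k_lin : linear k.
  move=> g N M; rewrite /k linearP (descend_is_linear H0) [g *: (c N + _)]scalerDr; exact: addrACA.
exists (HB.pack k (GRing.isLinear.Build _ _ _ _ k k_lin) : GammaNdual) => V N.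
rewrite wE -[N]NFbar_repr !transverse_part_dC //; set X := repr N.
rewrite /dN0 /nabla_dual /= /k !bott_connE !(descendE H0) raddfD /=.
rewrite -[dC a' _ _](subrK (dC a V X)) -dH [dC H _ _]/dC H0 raddf0 /=.
ring.
Qed.

Lemma transverse_part_cocycle (a : Omega1C C) : (forall V W : TF, dC a V W = 0) ->
  is_Omega1N (transverse_part (dC a)) /\ forall V W N, dN1 (transverse_part (dC a)) V W N = 0.
Proof.
move=> a0; split; first split.
- move=> V f N M; rewrite -[N]NFbar_repr -[M]NFbar_repr -NFbarZ -NFbarD.
  by rewrite !transverse_part_dC // dCr.
- by move=> N f V W; exact: dCl.
move=> V W N; rewrite -[N]NFbar_repr; set X := repr N.
rewrite /dN1 /nabla_dual !bott_connE !transverse_part_dC //.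
have := ddC a V W X; rewrite a0 raddf0 [dC a (lie V X) W]dCC [dC a (lie W X) V]dCC.
by move=> <- /=; ring.
Qed.

End FoliatedForms.

(* Main.v *)
(* If d_nu[beta] = 0, there are a function f, an extension a of beta + d_F f and
   a section c of N*F with p(da) = - d_{nabla*} c.  Pulled back along TC -> NF,
   the section c is a 1-form vanishing on the leaves, and p(dc) = d_{nabla*} c;
   hence a + c - df is the required extension of beta.  Its differential vanishes
   on TF x TF because beta is closed, and then it is determined by its transverse
   part, which is 0. *)
Require Import Defs.
From HB Require Import structures.
From mathcomp Require Import all_boot all_order all_algebra.
From mathcomp Require Import ring.
From mathcomp Require Import all_classical all_reals all_analysis.

Import GRing.Theory.

Local Open Scope classical_set_scope.
Local Open Scope ring_scope.

Section Correction.
Context {R : realType} {p q : nat} {C : manifold R (p + q)} {F : foliation C}.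
Context (a : Omega1C C) (c : GammaNdual F) (f : Cinf C).

Definition correction (X : vfield C) : (Cinf C)^o :=
  a X + c (NFbar F X) - vact X f.

Lemma correction_linear : linear correction.
Proof.
move=> g X Y; rewrite /correction form1D form1Z NFbarD NFbarZ linearP vactDl vactZl.
by rewrite -![_ *: _ : (Cinf C)^o]/(_ * _); ring.
Qed.

HB.instance Definition _ :=
  GRing.isLinear.Build (Cinf C) (vfield C) (Cinf C)^o _ correction
    correction_linear.

Lemma correction_leaf (V : TF F) : correction V = a V - vact V f.
Proof.
rewrite /correction (@NFbar_eq _ _ _ _ F V 0) ?subr0 ?TFP //.
by rewrite /NFbar !raddf0 addr0.
Qed.

(** The pullback of [c] kills [V], so its differential keeps only the terms of the dual Bott
    connection; [lie_lact] gives d(df) = 0. *)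
Lemma dC_correction (V : TF F) (X : vfield C) :
  dC correction V X = dC a V X + dN0 c V (NFbar F X).
Proof.
rewrite /dC correction_leaf /correction /dN0 /nabla_dual bott_connE lie_lact.
by rewrite !raddfB raddfD /=; ring.
Qed.

End Correction.

Theorem lemma2p12 (R : realType) (p q : nat) (C : manifold R (p + q))
    (F : foliation C) (beta : Omega1F F) :
  ((forall V W : TF F, dF beta V W = 0) /\
    dnu (H1F_class beta) = H1N_class (fun=> fun=> 0)) <->
  (exists betat : Omega1C C, extension_of betat beta /\
    forall (V : TF F) (X : vfield C), dC betat V X = 0).
Proof.
split=> [[beta0 dnu0]|[a [ab a0]]]; last first.
  have b0 V W : dF beta V W = 0 by rewrite -(dC_leaf ab).
  split=> //; rewrite (dnuE b0 ab); congr H1N_class.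
  by apply/funext => V; apply/funext => N; exact: a0.
(* The zero coset contains 0; membership of 0 in [dnu] then yields [f], [a] and [c]. *)
have : dnu (H1F_class beta) (fun=> fun=> 0).
  rewrite dnu0; exists (\0 : GammaNdual F) => V N.
  by rewrite /dN0 /nabla_dual /= raddf0 subr0 addr0.
move=> [b [a [[f bE] ab [c wE]]]].
have tb : extension_of (correction a c f) beta.
  by move=> V; rewrite /= correction_leaf ab bE addrK.
have t0 (V W : TF F) : dC (correction a c f) V W = 0 by rewrite (dC_leaf tb).
exists (correction a c f); split=> // V X.
(* By [t0], [X] may be traded for the chosen representative of its class, where [wE] evaluates
   [dC a]. *)
rewrite -(transverse_part_dC t0) /transverse_part.
by rewrite dC_correction NFbar_repr -wE.
Qed.
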